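(* Let $\kappa$ be an infinite cardinal and $\lambda$ a cardinal. A function $F:{}^{\lambda}\kappa\to\kappa$ is a weakly uniform proper coloring if and only if there are a $\kappa^{+}$-complete ultrafilter $\mathscr{U}$ on $\lambda$ and a permutation $\pi\in \mathrm{Sym}(\kappa)$ such that for all $x\in{}^{\lambda}\kappa$ and $\alpha\in\kappa$, $$F(x)=\pi(\alpha)\iff \{i\in\lambda : x(i)=\alpha\}\in\mathscr{U}.$$
   Context: ${}^{\lambda}\kappa$ is the set of all functions from $\lambda$ to $\kappa$. Two functions $x,y\in{}^{\lambda}\kappa$ are totally different, written $x\perp y$, if $x(i)\neq y(i)$ for all $i\in\lambda$. A function $F:{}^{\lambda}\kappa\to\kappa$ is a proper coloring if $F(x)\ne F(y)$ whenever $x,y\in{}^{\lambda}\kappa$ and $x\perp y$. A proper coloring $F:{}^{\lambda}\kappa\to\kappa$ is weakly uniform if there is a sequence $(r_\alpha)_{\alpha<\kappa}$ in ${}^{\lambda}\kappa$ such that $F(r_\alpha)=\alpha$ for all $\alpha\in\kappa$ and $r_\alpha\perp r_\beta$ for all $\alpha\ne\beta$ in $\kappa$. $\mathrm{Sym}(A)$ is the set of all bijections $A\to A$. An ultrafilter is $\kappa^{+}$-complete if it is closed under intersections of at most $\kappa$ many of its members. *)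

(* Defs.v *)
From mathcomp Require Import all_boot.
From mathcomp Require Import boolp classical_sets functions cardinality filter.

Set Implicit Arguments.
Unset Strict Implicit.
Unset Printing Implicit Defensive.

Local Open Scope classical_set_scope.
Local Open Scope card_scope.

(* The cardinals kappa and lambda are given by arbitrary types K and L of these
   cardinalities: nothing below uses more of them than their underlying sets. *)

Definition totally_different (L K : Type) (x y : L -> K) : Prop :=
  forall i : L, x i <> y i.

Definition proper_coloring (L K : Type) (F : (L -> K) -> K) : Prop :=
  forall x y : L -> K, totally_different x y -> F x <> F y.

Definition weakly_uniform (L K : Type) (F : (L -> K) -> K) : Prop :=
  exists r : K -> (L -> K),
    (forall a : K, F (r a) = a) /\
    (forall a b : K, a <> b -> totally_different (r a) (r b)).

(* kappa^+-completeness. The empty family is allowed; its intersection is the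
   whole of L, which belongs to every filter. *)
Definition succ_complete (K L : Type) (U : set_system L) : Prop :=
  forall G : set (set L), G #<= [set: K] -> G `<=` U ->
    U (\bigcap_(A in G) A).
Arguments succ_complete K {L} U.

(* Main.v *)
(** Write [r] for the rainbow family of the coloring and call a set [A] large
    when the function equal to [r a] on [A] and to [r b] off [A] always gets the
    color [a].  A function with values among [r a, r b] differs everywhere from
    every other [r c], so it has color [a] or [b]: exactly one of [A] and its
    complement is large.  If [F x = a], two rounds of comparing [x] with such
    two-valued functions show that [{i | x i = r a i}] is large.  Applied to
    [i |-> r (h i) i], this says that every partition of [L] into [K]-many
    pieces has a large piece, which gives completeness.  Finally [p a] is the
    color of the constant function [a]. *)

Require Import Defs.
From mathcomp Require Import all_boot.
From mathcomp Require Import boolp classical_sets functions cardinality filter.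

Local Open Scope classical_set_scope.
Local Open Scope card_scope.

Lemma card_le_setT_inj (T K : Type) (A : set T) :
  A #<= [set: K] -> A !=set0 -> exists f : T -> K, {in A &, injective f}.
Proof.
elim/Ppointed: K => K; last by move=> /pcard_injP.
by rewrite (empty_eq0 [set: K]) card_le0 => /eqP -> [].
Qed.

Lemma infinite_setT_distinct3 (K : Type) : infinite_set [set: K] ->
  exists a b c : K, [/\ a <> b, a <> c & b <> c].
Proof.
move=> /infiniteP /card_le_setT_inj [|f f_inj]; first by exists 0%N.
by exists (f 0%N), (f 1%N), (f 2%N); split=> /f_inj; rewrite !in_setT => /(_ isT isT).
Qed.

Lemma ultra_of_setVsetC (L : Type) (U : set_system L) : ProperFilter U ->
  (forall A, U A \/ U (~` A)) -> UltraFilter U.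
Proof.
move=> UF UC; split=> // G GF UG; apply/seteqP; split=> // A GA.
have [//|/UG GnA] := UC A.
by case: (@filter_not_empty _ G GF); rewrite -(setICr A); apply: filterI.
Qed.

(** Send each [i] to a member [A i] of [G] omitting [i], if there is one. This map is constant on
    some set of [U]; intersecting that set with its constant value leaves only points that lie in
    all members of [G]. *)
Lemma succ_complete_of_fibers (K L : Type) (U : set_system L) :
  ProperFilter U ->
  (forall h : L -> K, exists a, U [set i | h i = a]) -> succ_complete K U.
Proof.
move=> UF Ufib G GK GU.
have [G0|/set0P G0] := eqVneq G set0.
  by rewrite G0 bigcap_set0; exact: filterT.
have [f f_inj] := card_le_setT_inj _ _ _ GK G0; have [A0 GA0] := G0.
have [A AP] : {A : L -> set L &
    forall i, G (A i) /\ ((forall B, G B -> B i) \/ ~ A i i)}.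
  apply: (choice (P := fun i A => G A /\ ((forall B, G B -> B i) \/ ~ A i))) => i.
  have [iG|/existsNP[A /not_implyP[GA nAi]]] :=
    pselect (forall B, G B -> B i); first by exists A0; split=> //; left.
  by exists A; split=> //; right.
have [a Ua] := Ufib (f \o A); have [i /= fia] := filter_ex Ua.
have [GAi _] := AP i.
apply: filterS (filterI Ua (GU _ GAi)) => j [/= fja Aij].
have [GAj []//] := AP j.
by rewrite (_ : A j = A i) //; apply: f_inj; rewrite ?inE ?fia.
Qed.

Definition mix {L K : Type} (A : set L) (x y : L -> K) : L -> K :=
  fun i => if pselect (A i) then x i else y i.

Lemma mixC {L K : Type} (A : set L) (x y : L -> K) :
  mix (~` A) x y = mix A y x.
Proof.
by apply/funext => i; rewrite /mix; case: pselect; case: pselect.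
Qed.

Lemma mix_fiber {L K : Type} (A : set L) (x y : L -> K) :
  totally_different x y -> [set i | mix A x y i = x i] = A.
Proof.
move=> xy; apply/seteqP; split=> i /=; rewrite /mix; case: pselect => //.
by move=> _ /esym/xy.
Qed.

Section weakly_uniform_coloring.
Variables (K L : Type) (F : (L -> K) -> K) (r : K -> L -> K).
Hypothesis F_proper : proper_coloring F.
Hypothesis Fr : forall a, F (r a) = a.
Hypothesis r_diff : forall a b, a <> b -> totally_different (r a) (r b).

Definition large : set_system L :=
  [set A | forall a b, a <> b -> F (mix A (r a) (r b)) = a].

Lemma color_mix A a b :
  F (mix A (r a) (r b)) = a \/ F (mix A (r a) (r b)) = b.
Proof.
set c := F _; have [ca|ca] := pselect (c = a); first by left.
have [cb|cb] := pselect (c = b); first by right.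
suff diff : totally_different (mix A (r a) (r b)) (r c) by case: (F_proper _ _ diff); rewrite Fr.
by move=> i; rewrite /mix; case: pselect => /= _; apply: r_diff; apply/nesym.
Qed.

Lemma color_mix_fiber x a b : F x = a -> b <> a ->
  F (mix [set i | x i = r a i] (r b) (r a)) = b.
Proof.
move=> Fx ba; have [//|Fa] := color_mix [set i | x i = r a i] b a.
suff diff : totally_different (mix [set i | x i = r a i] (r b) (r a)) x.
  by case: (F_proper _ _ diff); rewrite Fa Fx.
move=> i; rewrite /mix; case: pselect => /= [->|xi]; first exact: r_diff.
exact/nesym.
Qed.

Lemma large_fiber x a : F x = a -> large [set i | x i = r a i].
Proof.
move=> Fx c d cd; have [->|da] := pselect (d = a).
  have [ca|ca] := pselect (c = a); last exact: color_mix_fiber.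
  have [->//|] := color_mix [set i | x i = r a i] c a.
  by rewrite ca.
(* Second round: the mix of color [d] agrees with [r d] on the same set, so it can take the place of
   [x]. *)
have /color_mix_fiber /(_ cd) := color_mix_fiber _ _ _ Fx da.
by rewrite mix_fiber //; exact: r_diff.
Qed.

Lemma large_partition (h : L -> K) : exists a, large [set i | h i = a].
Proof.
(* Distinct [r a] differ at every point, so [x] agrees with [r a] exactly where [h] is [a]. *)
pose x i := r (h i) i; exists (F x).
rewrite (_ : mkset _ = [set i | x i = r (F x) i]); first exact: large_fiber.
apply/seteqP; split=> i /=; first by rewrite /x => ->.
by move=> xi; apply: contrapT => /r_diff /(_ i).
Qed.

Hypothesis K3 : exists a b c : K, [/\ a <> b, a <> c & b <> c].

Lemma largeVC A : large A \/ large (~` A).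
Proof.
have [a [b [_ [ab _ _]]]] := K3.
have [/large_fiber|/large_fiber] := color_mix A a b.
  by rewrite mix_fiber; [left|exact: r_diff].
by rewrite -mixC mix_fiber; [right|apply/r_diff/nesym].
Qed.

(** Given three colors, disjoint [A] and [B] would yield two totally different mixes, both of color
    [a]. *)
Lemma large_meet A B : large A -> large B -> exists i, A i /\ B i.
Proof.
have [a [b [c [ab ac bc]]]] := K3 => UA UB; apply: contrapT => /forallNP AB.
suff diff : totally_different (mix A (r a) (r b)) (mix B (r a) (r c)).
  by case: (F_proper _ _ diff); rewrite UA // UB.
move=> i; rewrite /mix; case: pselect => Ai; case: pselect => Bi /=.
- by case: (AB i).
- exact: r_diff.
- by apply: r_diff; apply/nesym.
- exact: r_diff.
Qed.

Lemma large_proper : ProperFilter large.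
Proof.
have large0 : ~ large set0 by move=> U0; have [i []] := large_meet _ _ U0 U0.
have largeS (A B : set L) : A `<=` B -> large A -> large B.
  move=> AB UA; have [//|UnB] := largeVC B.
  by have [i [/AB]] := large_meet _ _ UA UnB.
split=> //; split=> //.
  by have [//|] := largeVC setT; rewrite setCT.
move=> P Q UP UQ; have [a [b [c [ab ac bc]]]] := K3.
(* The large piece meets [P], which excludes [a], and [Q], which excludes [b]; hence it is the
   intersection of [P] and [Q]. *)
pose h i := if pselect (P i) then if pselect (Q i) then c else b else a.
have [d Ud] := large_partition h.
suff dc : d = c.
  apply: largeS Ud => i; rewrite /h /= dc.
  by case: pselect => // Pi; case: pselect.
have [i [+ Pi]] := large_meet _ _ Ud UP; have [j [+ Qj]] := large_meet _ _ Ud UQ.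
rewrite /h /=; case: (pselect (P i)) => //= _; case: (pselect (Q j)) => //= _.
case: pselect => /= _ <-; case: pselect => /= _ //.
by move=> /esym.
Qed.

Lemma color_large x a : F x = a <-> large [set i | x i = r a i].
Proof.
split=> [|Ua]; first exact: large_fiber.
(* Otherwise [x] would agree with [r a] and with [r (F x)] on disjoint large sets. *)
apply: contrapT => /r_diff Fxa.
have [i [/= xa xF]] := large_meet _ _ Ua (large_fiber x _ erefl).
by apply: (Fxa i); rewrite -xa -xF.
Qed.

Lemma color_cst a b : F (fun=> a) = b <-> large [set i | r b i = a].
Proof.
rewrite color_large (_ : mkset _ = [set i | r b i = a]) //.
by apply/seteqP; split=> i /= ->.
Qed.

(** Each [r b] takes some value on a large set, and only one since large sets meet; that value is
    the preimage of [b]. *)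
Lemma color_cst_bij : bijective (fun a => F (fun=> a)).
Proof.
have [q qP] : {q : K -> K & forall b, F (fun=> q b) = b}.
  apply: (choice (P := fun b a => F (fun=> a) = b)) => b.
  by have [a Ua] := large_partition (r b); exists a; apply/color_cst.
exists q => // a.
have /color_cst Uq := qP (F (fun=> a)).
have /color_cst Ua := erefl (F (fun=> a)).
by have [i [/= <-]] := large_meet _ _ Uq Ua.
Qed.

Lemma color_large_cst x a :
  F x = F (fun=> a) <-> large [set i | x i = a].
Proof.
(* The function [r (F (fun=> a))] equals [a] on a large set, so it may be exchanged for the
   constant. *)
have UF := large_proper; have /color_cst Ua := erefl (F (fun=> a)).
rewrite color_large; split=> Ux; apply: filterS (filterI Ux Ua) => i [/=].
  by move=> -> ->.
by move=> -> ->.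
Qed.

End weakly_uniform_coloring.

Theorem theorem3p10 (K L : Type) (K_infinite : infinite_set [set: K])
    (F : (L -> K) -> K) :
  proper_coloring F /\ weakly_uniform F <->
  exists (U : set_system L) (p : K -> K),
    [/\ UltraFilter U, succ_complete K U, bijective p &
        forall (x : L -> K) (a : K), F x = p a <-> U [set i | x i = a]].
Proof.
split=> [[F_proper [r [Fr r_diff]]]|[U [p [UF _ [q pK qK] FU]]]].
  have K3 := infinite_setT_distinct3 _ K_infinite.
  have UF := large_proper _ _ _ _ F_proper Fr r_diff K3.
  exists (large _ _ F r), (fun a => F (fun=> a)); split.
  - exact: ultra_of_setVsetC (largeVC _ _ _ _ F_proper Fr r_diff K3).
  - exact: succ_complete_of_fibers (large_partition _ _ _ _ F_proper Fr r_diff).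
  - exact: (color_cst_bij _ _ _ _ F_proper Fr r_diff K3).
  - exact: (color_large_cst _ _ _ _ F_proper Fr r_diff K3).
split=> [x y xy Fxy|].
  (* If the colors agree, [x] and [y] both take the value [q (F x)] on sets of [U], and these
     meet. *)
  have Ux := (FU x (q (F x))).1 (esym (qK _)).
  have Uy := (FU y (q (F x))).1 (etrans (esym Fxy) (esym (qK _))).
  by have [i [/= xi yi]] := filter_ex (filterI Ux Uy); case: (xy i); rewrite xi yi.
(* The constant functions, reindexed by the inverse of [p], form the rainbow family. *)
exists (fun a _ => q a); split=> [a|a b ab i /(can_inj qK)//].
rewrite -[RHS]qK; apply/FU; rewrite (_ : mkset _ = setT); first exact: filterT.
by apply/seteqP; split.
Qed.
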